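(* Let $p$ be a prime number. Then there exist exactly $\lvert\{t\in\mathbb{N}\mid t \text{ divides } p-1\}\rvert+3$ different clones on $\mathbb{Z}_p$ which contain the binary operation $+$.
   Context: $\mathbb{N}=\{1,2,3,\dots\}$. A clone on a set $A$ is a set of finitary operations on $A$ (of arities $n\ge 1$) that contains all projections $\pi_j^n(x_1,\dots,x_n)=x_j$ ($1\le j\le n$) and is closed under composition, i.e. $f(g_1,\dots,g_n)\in C$ whenever $f\in C$ is $n$-ary and $g_1,\dots,g_n\in C$ are all $m$-ary. Here $+$ is addition modulo $p$. *)

(* Defs.v *)
From mathcomp Require Import all_boot all_algebra.
From mathcomp Require Import all_classical.

Set Implicit Arguments.
Unset Strict Implicit.
Unset Printing Implicit Defensive.

Import GRing.Theory.
Local Open Scope classical_set_scope.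
Local Open Scope ring_scope.

Definition operation (A : Type) (n : nat) : Type := ('I_n -> A) -> A.

(* Operations have arity at least 1, so a set of finitary operations is given *)
(* by its (n+1)-ary part for every n; the index is the arity minus one.       *)
Definition operation_set (A : Type) : Type :=
  forall n : nat, set (operation A n.+1).

Definition projection (A : Type) (n : nat) (j : 'I_n) : operation A n :=
  fun x => x j.

Definition composition (A : Type) (n m : nat) (f : operation A n)
    (g : 'I_n -> operation A m) : operation A m :=
  fun x => f (fun i => g i x).

Definition is_clone (A : Type) (C : operation_set A) : Prop :=
  (forall (n : nat) (j : 'I_n.+1), C n (projection j)) /\
  (forall (n m : nat) (f : operation A n.+1) (g : 'I_n.+1 -> operation A m.+1),
     C n f -> (forall i, C m (g i)) -> C m (composition f g)).

Definition addition (V : zmodType) : operation V 2 :=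
  fun x => x ord0 + x ord_max.
Arguments addition : clear implicits.

(* Main.v *)
Require Import Defs.
From mathcomp Require Import all_boot all_algebra all_fingroup all_solvable.
From mathcomp Require Import all_classical finmap.
From mathcomp Require Import ring.

(** The clones containing addition over the field of [p] elements are: the
    linear operations, the affine operations, all operations, and for each
    divisor [t] of [p - 1] the operations [f] with [f 0 = 0] and
    [f (a x) = a (f x)] whenever [a ^+ t = 1].

    That nothing else occurs rests on one fact: a clone [C] that contains the
    linear operations and some non-affine operation consists of all operations
    that commute with the multipliers of [C], the scalars with which all members
    of [C] commute ([mem_nonaffine_clone]). To prove it, the additivity defect of
    a non-affine operation provides a binary operation [m] in [C] that is not
    identically zero but vanishes when one argument does ([nonaffine_bump]).
    Using [m] as a product, an operation belongs to [C] as soon as it can be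
    interpolated by [C] on any two points ([two_point_interpolation]). On two
    points the only obstruction to interpolation is that they are proportional
    with a multiplier as ratio ([multiplier_interpolation]).

    The nonzero multipliers form a subgroup of the multiplicative group, so they
    are the [t]-th roots of unity for some [t] dividing [p - 1]
    ([multipliers_roots]). A non-affine clone in which [0] is no multiplier
    contains all operations. Over a prime field, the clones without non-affine
    operations are the linear and the affine operations. The clones in the list
    are told apart by the powers [x ^+ t.+1], the constant [1] and one
    non-affine binary operation ([prime_field_clones_uniq]). *)

Set Implicit Arguments.
Unset Strict Implicit.
Unset Printing Implicit Defensive.
Import GRing.Theory.

Local Open Scope ring_scope.
Local Open Scope classical_set_scope.
Local Open Scope card_scope.

(** * Clones of a field containing the linear operations *)

Lemma eq_operation (A : Type) (C : operation_set A) n (f g : operation A n.+1) :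
  f =1 g -> C n f -> C n g.
Proof. by move/funext->. Qed.

(** Over a prime field the scalings are sums of copies of a variable and come
    for free with addition; over a general field they have to be required. *)
Definition linear_clone (F : fieldType) (C : operation_set F) : Prop :=
  [/\ is_clone C, C 1%N (addition F)
    & forall a : F, C 0%N (fun x => a * x ord0)].

Lemma linear_clone_proj (F : fieldType) (C : operation_set F) n (j : 'I_n.+1) :
  linear_clone C -> C n (fun x => x j).
Proof. by case=> -[Cproj _] _ _; exact: Cproj. Qed.

Lemma linear_clone_comp (F : fieldType) (C : operation_set F) n m
    (f : operation F n.+1) (g : 'I_n.+1 -> operation F m.+1) :
  linear_clone C -> C n f -> (forall i, C m (g i)) ->
  C m (fun x => f (fun i => g i x)).
Proof. by case=> -[_ Ccomp] _ _; exact: Ccomp. Qed.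

Lemma clone_add (V : zmodType) (C : operation_set V) n (f g : operation V n.+1) :
  is_clone C -> C 1%N (addition V) -> C n f -> C n g -> C n (f \+ g).
Proof.
move=> [_ Ccomp] Cadd Cf Cg.
apply: (Ccomp _ _ (addition V) (fun i => if i == ord0 then f else g)) => // i.
by case: ifP.
Qed.

Lemma linear_clone_add (F : fieldType) (C : operation_set F) n
    (f g : operation F n.+1) :
  linear_clone C -> C n f -> C n g -> C n (f \+ g).
Proof. by case=> *; exact: clone_add. Qed.

Lemma linear_clone_scale (F : fieldType) (C : operation_set F) n a
    (f : operation F n.+1) :
  linear_clone C -> C n f -> C n (a \*o f).
Proof.
move=> lC Cf; case: (lC) => _ _ Cscale.
exact: (linear_clone_comp (g := fun=> f) lC (Cscale a)).
Qed.

Lemma linear_clone0 (F : fieldType) (C : operation_set F) n :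
  linear_clone C -> C n (fun=> 0).
Proof.
move=> lC; have CE := linear_clone_scale 0 lC (linear_clone_proj (@ord0 n) lC).
by apply: (eq_operation _ CE) => x; rewrite /= mul0r.
Qed.

Lemma linear_clone_sub (F : fieldType) (C : operation_set F) n
    (f g : operation F n.+1) :
  linear_clone C -> C n f -> C n g -> C n (fun x => f x - g x).
Proof.
move=> lC Cf Cg.
have CE := linear_clone_add lC Cf (linear_clone_scale (-1) lC Cg).
by apply: (eq_operation _ CE) => x /=; rewrite mulN1r.
Qed.

(** A value [f 0 != 0] is itself a constant operation of the clone, since [0] is
    a linear form; scaling it yields every constant. *)
Lemma linear_clone_const (F : fieldType) (C : operation_set F) n m c
    (f : operation F n.+1) :
  linear_clone C -> C n f -> f (fun=> 0) != 0 -> C m (fun=> c).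
Proof.
move=> lC Cf f0.
have CE := linear_clone_scale (c / f (fun=> 0)) lC
          (linear_clone_comp lC Cf (fun=> linear_clone0 m lC)).
by apply: (eq_operation _ CE) => x /=; rewrite divfK.
Qed.

Lemma linear_clone_sum (F : fieldType) (C : operation_set F) n (I : Type)
    (r : seq I) (f : I -> operation F n.+1) :
  linear_clone C -> (forall i, C n (f i)) -> C n (fun x => \sum_(i <- r) f i x).
Proof.
move=> lC Cf; elim: r => [|i r IHr].
  by have CE := linear_clone0 n lC; apply: (eq_operation _ CE) => x; rewrite big_nil.
have CE := linear_clone_add lC (Cf i) IHr.
by apply: (eq_operation _ CE) => x; rewrite big_cons.
Qed.

(** * Interpolation by a clone with a non-affine operation *)

(** The subtraction-free form of: [f - f 0] is additive. *)
Definition affine (V : zmodType) n (f : operation V n) : Prop :=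
  forall x y, f (x \+ y) + f (fun=> 0) = f x + f y.

(** Non-affinity at [x], [y] is the statement that the defect
    [s, t |-> f (s x + t y) - f (s x) - f (t y) + f 0] does not vanish at [(1, 1)],
    while it vanishes on both axes because terms cancel in pairs there. Such an
    operation can serve as a product. *)
Lemma nonaffine_bump (F : fieldType) (C : operation_set F) n
    (f : operation F n.+1) :
  linear_clone C -> C n f -> ~ affine f ->
  exists m : operation F 2,
    [/\ C 1%N m, forall s i, s i = 0 -> m s = 0 & exists w, m w != 0].
Proof.
move=> lC Cf /existsNP[x /existsNP[y fxy]].
(* The four terms of the defect are at_ b c with b, c in {0, 1}. *)
pose at_ (b c : F) (s : 'I_2 -> F) := f (fun i => s ord0 * (b * x i) + s ord_max * (c * y i)).
have Cat b c : C 1%N (at_ b c).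
  apply: (linear_clone_comp
    (g := fun i s => s ord0 * (b * x i) + s ord_max * (c * y i)) lC Cf) => i.
  have CE := linear_clone_add lC
    (linear_clone_scale (b * x i) lC (linear_clone_proj (@ord0 1) lC))
    (linear_clone_scale (c * y i) lC (linear_clone_proj (@ord_max 1) lC)).
  apply: (eq_operation _ CE) => s /=.
  by rewrite ![s _ * _]mulrC.
exists (fun s => (at_ 1 1 s + at_ 0 0 s) - (at_ 1 0 s + at_ 0 1 s)); split.
- by apply: linear_clone_sub => //; apply: linear_clone_add.
- have at_l b c s : s ord0 = 0 -> at_ b c s = at_ 0 c s.
    by move=> s0; congr f; apply: funext => j; rewrite s0 !mul0r.
  have at_r b c s : s ord_max = 0 -> at_ b c s = at_ b 0 s.
    by move=> s1; congr f; apply: funext => j; rewrite s1 !mul0r.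
  move=> s i si0; case: (i =P ord0) si0 => [-> s0|/eqP i0 si0].
    by rewrite (at_l 1 1) // (at_l 1 0) // [X in X - _]addrC subrr.
  have s1 : s ord_max = 0.
    by rewrite -si0; congr s; case: i i0 {si0} => [[|[|?]] ?] // _; apply: val_inj.
  by rewrite (at_r 1 1) // (at_r 0 1) // subrr.
- exists (fun=> 1); rewrite subr_eq0; apply/eqP => fE; apply: fxy.
  have at1 b c z : (forall i, z i = b * x i + c * y i) -> at_ b c (fun=> 1) = f z.
    by move=> zE; congr f; apply: funext => j; rewrite zE !mul1r.
  rewrite (at1 1 1 (x \+ y)) ?(at1 0 0 (fun=> 0)) ?(at1 1 0 x) ?(at1 0 1 y) // in fE
    => j; by rewrite ?mul0r ?mul1r ?addr0 ?add0r.
Qed.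

(** A Baker-Pixley argument: the bump [m], which vanishes as soon as one of its
    arguments does, reduces interpolation of [f] on all points to interpolation
    on pairs of points. If [g] agrees with [f] on [s] but not at [y], and [k]
    agrees with [f] at [x] and [y], then [g - k] vanishes at [x] and not at [y];
    [m] multiplies such differences into one operation that vanishes on all of
    [s] and not at [y], which serves to correct [g] at [y] in the manner of
    Newton interpolation. *)
Lemma two_point_interpolation (F : finFieldType) (C : operation_set F)
    (m : operation F 2) (w : 'I_2 -> F) n (f : operation F n.+1) :
  linear_clone C -> C 1%N m -> (forall s i, s i = 0 -> m s = 0) -> m w != 0 ->
  (forall x y, exists2 g, C n g & g x = f x /\ g y = f y) -> C n f.
Proof.
move=> lC Cm m0 mw f2.
have isolate (s : seq {ffun 'I_n.+1 -> F}) g y : C n g -> g y <> f y ->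
    (forall x : {ffun 'I_n.+1 -> F}, x \in s -> g x = f x) ->
    exists h, [/\ C n h, h y != 0 & forall x : {ffun 'I_n.+1 -> F}, x \in s -> h x = 0].
  move=> Cg gy; elim: s => [|x s IHs] gs.
    have [k Ck [ky _]] := f2 y y.
    exists (fun z => g z - k z); split => //; first exact: linear_clone_sub.
    by rewrite ky subr_eq0; apply/eqP.
  have [h [Ch hy hs]] : exists h, [/\ C n h, h y != 0
      & forall x : {ffun 'I_n.+1 -> F}, x \in s -> h x = 0].
    by apply: IHs => z zs; apply: gs; rewrite inE zs orbT.
  have [k Ck [kx ky]] := f2 x y.
  pose H (i : 'I_2) z := if i == ord0 then h z else g z - k z.
  have CH i : C n (H i).
    by rewrite /H; case: (i == ord0) => //; exact: linear_clone_sub.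
  have Hy i : H i y != 0.
    by rewrite /H; case: ifP => // _; rewrite ky subr_eq0; apply/eqP.
  (* Both factors are rescaled so that their values at y are the entries of w. *)
  exists (fun z => m (fun i => w i / H i y * H i z)); split.
  - apply: (linear_clone_comp lC Cm (g := fun i z => _)) => i.
    exact: (linear_clone_scale _ lC (CH i)).
  - by under [X in m X]funext => i do rewrite divfK //.
  - move=> z; rewrite inE => /predU1P[->|zs].
      have Hx : H ord_max x = 0 by rewrite /H /= kx gs ?subrr ?inE ?eqxx.
      by apply: (m0 _ ord_max); rewrite Hx mulr0.
    have Hz : H ord0 z = 0 by rewrite /H /= hs.
    by apply: (m0 _ ord0); rewrite Hz mulr0.
have [g Cg gf] : exists2 g, C n g &
    forall x : {ffun 'I_n.+1 -> F}, x \in enum {ffun 'I_n.+1 -> F} -> g x = f x.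
  elim: (enum _) => [|y s [g Cg gs]].
    by exists (fun=> 0) => //; exact: linear_clone0.
  have [gy|gy] := pselect (g y = f y).
    by exists g => // x; rewrite inE => /predU1P[->|/gs].
  have [h [Ch hy hs]] := isolate s g y Cg gy gs.
  (* h vanishes on s, so the correction at y preserves the agreement on s. *)
  exists (g \+ ((f y - g y) / h y) \*o h).
    by apply: linear_clone_add => //; exact: linear_clone_scale.
  move=> x; rewrite inE /= => /predU1P[->|xs].
    by rewrite divfK // addrC subrK.
  by rewrite (gs x) // (hs x) // mulr0 addr0.
(* Points are functions, which do not form a finite type; the enumeration above
   ranges over their tabulated forms. *)
have -> : f = g; last by [].
apply: funext => x.
have -> : x = [ffun i => x i] :> (_ -> _) by apply: funext => i; rewrite ffunE.
by rewrite gf // mem_enum.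
Qed.

(** Cramer's rule: the coefficients below solve the system with determinant [D]. *)
Lemma two_point_span (F : fieldType) (C : operation_set F) n
    (g h : operation F n.+1) x y c d :
  linear_clone C -> C n g -> C n h -> g x * h y != g y * h x ->
  exists2 k, C n k & k x = c /\ k y = d.
Proof.
rewrite -subr_eq0 => lC Cg Ch.
set D := _ - _ => D0.
exists (((c * h y - d * h x) / D) \*o g \+ ((d * g x - c * g y) / D) \*o h).
  by apply: linear_clone_add => //; exact: linear_clone_scale.
by split; rewrite /= /D in D0 *; field.
Qed.

(** The scalar endomorphisms of the algebra [(F; C)]; that [0] is one of them
    means that every operation of the clone fixes [0]. *)
Definition multiplier (F : fieldType) (C : operation_set F) (a : F) : Prop :=
  forall n f, C n f -> forall x, f (a \*o x) = a * f x.

(** If some two operations of the clone take linearly independent values on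
    [(x, y)], all pairs of values are attained. Otherwise all pairs [(g x, g y)]
    are proportional. Applied to coordinates this gives, up to exchanging the
    points, [y = a x] with [x != 0]; applied to [h] composed with a linear map
    taking [x] to an arbitrary [z] it gives [h (a z) = a (h z)], so that [a] is a
    multiplier. Then [f y = a (f x)] and a linear form interpolates [f]. When both
    points are [0], the same dichotomy is whether [0] is a multiplier. *)
Lemma multiplier_interpolation (F : fieldType) (C : operation_set F) n
    (f : operation F n.+1) x y :
  linear_clone C ->
  (forall a, multiplier C a -> forall z, f (a \*o z) = a * f z) ->
  exists2 g, C n g & g x = f x /\ g y = f y.
Proof.
move=> lC fM.
have [[g [h [Cg Ch gh]]]|dep] := pselect (exists g h,
    [/\ C n g, C n h & g x * h y != g y * h x]).
  exact: two_point_span gh.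
have {}dep g h : C n g -> C n h -> g x * h y = g y * h x.
  move=> Cg Ch; apply: contrapT => /eqP gh; apply: dep.
  by exists g, h.
(* Either x != 0, after exchanging x and y if necessary, or x = y = 0. *)
wlog x0 : x y dep / (exists i, x i != 0) \/ x = (fun=> 0) /\ y = (fun=> 0).
  move=> wl; have [x0|x0] := pselect (exists i, x i != 0); first by apply: wl => //; left.
  have [y0|y0] := pselect (exists i, y i != 0).
    have dep' g h : C n g -> C n h -> g y * h x = g x * h y.
      by move=> Cg Ch; rewrite -dep.
    by have [g Cg [gy gx]] := wl y x dep' (or_introl y0); exists g.
  apply: wl => //; right; split; apply: funext => i; apply: contrapT => /eqP ?.
    by apply: x0; exists i.
  by apply: y0; exists i.
case: x0 => [[i xi]|[-> ->]].
  pose a := y i / x i.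
  have ratio g : C n g -> g y = a * g x.
    move=> Cg; have := dep _ _ Cg (linear_clone_proj i lC) => /= E.
    by apply: (mulIf xi); rewrite -E /a; field.
  have yE : y = a \*o x.
    by apply: funext => j; rewrite (ratio _ (linear_clone_proj j lC)).
  have aM : multiplier C a.
    move=> k h Ch z.
    (* The linear map v |-> (v i / x i) z takes x to z and y to a z. *)
    have := ratio (fun v => h (fun j => z j / x i * v i)).
    rewrite yE /=.
    under [X in h X]funext => j do rewrite mulrA [_ * a]mulrC -mulrA divfK //.
    under [X in _ * h X]funext => j do rewrite divfK //.
    apply; apply: (linear_clone_comp lC Ch (g := fun j v => _)) => j.
    exact: (linear_clone_scale _ lC (linear_clone_proj i lC)).
  exists ((f x / x i) \*o (fun v => v i)).
    exact: linear_clone_scale (linear_clone_proj i lC).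
  by rewrite yE fM //=; split; field.
have [M0|] := pselect (multiplier C 0).
  exists (fun=> 0); first exact: linear_clone0.
  have := fM 0 M0 (fun=> 0); rewrite mul0r.
  by under [X in f X]funext => j do rewrite /= mul0r.
move=> /existsNP[k /existsNP[h /not_implyP[Ch /existsNP[z]]]].
rewrite mul0r; under [X in h X]funext => j do rewrite /= mul0r.
move=> /eqP h0; exists (fun=> f (fun=> 0)) => //.
exact: linear_clone_const h0.
Qed.

(** Hence a clone with a non-affine operation is recovered from its multipliers. *)
Lemma mem_nonaffine_clone (F : finFieldType) (C : operation_set F) n
    (f : operation F n.+1) :
  linear_clone C -> (exists k (g : operation F k.+1), C k g /\ ~ affine g) ->
  (forall a, multiplier C a -> forall z, f (a \*o z) = a * f z) -> C n f.
Proof.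
move=> lC [k [g [Cg gaff]]] fM.
have [m [Cm m0 [w mw]]] := nonaffine_bump lC Cg gaff.
by apply: (two_point_interpolation lC Cm m0 mw) => x y; exact: multiplier_interpolation.
Qed.

(** * The multipliers of a clone over a finite field *)

(** The nonzero multipliers form a subgroup of the multiplicative group of [F];
    if its order is [t], its elements are [t] roots of [X^t - 1] and therefore
    all of them. Stating this as [a ^+ t.+1 = a] covers [a = 0] as well. *)
Lemma multipliers_roots (F : finFieldType) (C : operation_set F) :
  multiplier C 0 ->
  exists2 t, (t %| #|F|.-1)%N & forall a, multiplier C a <-> a ^+ t.+1 = a.
Proof.
move=> M0.
pose M := [set u : {unit F} | `[< multiplier C (val u) >]]%SET.
have memM u : (u \in M) = `[< multiplier C (val u) >] by rewrite inE.
have gM : group_set M.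
  apply/group_setP; split=> [|u v].
    rewrite memM; apply/asboolP => n f _ x; rewrite mul1r; congr f.
    by apply: funext => i; rewrite /= mul1r.
  rewrite !memM => /asboolP uM /asboolP vM; apply/asboolP => n f Cf x.
  rewrite -mulrA -(vM _ _ Cf) -(uM _ _ Cf); congr f.
  by apply: funext => i; rewrite /= mulrA.
pose t := #|M|.
have Mt u : u \in M -> val u ^+ t = 1.
  by move=> uM; rewrite -FinRing.val_unitX (expg_cardG (G := group gM) uM).
have t0 : (0 < t)%N by exact: (cardG_gt0 (group gM)).
have rootsM : t.-unity_root =i [seq val u | u <- enum M].
  apply: mem_unity_roots => //.
  - apply/allP => _ /mapP[u uM ->]; rewrite mem_enum in uM.
    by apply/unity_rootP; exact: Mt.
  - by rewrite map_inj_uniq ?enum_uniq //; exact: val_inj.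
  - by rewrite size_map -cardE.
exists t => [|a].
  by rewrite -card_finField_unit (@cardSg _ [group of [set: {unit F}]] (group gM)) ?finset.subsetT.
have [->|a0] := eqVneq a 0; first by rewrite exprS mul0r.
rewrite exprS; split=> [aM|].
  have ua : a \is a GRing.unit by rewrite unitfE.
  have := Mt (FinRing.Unit ua); rewrite memM => -> /=; first by rewrite mulr1.
  exact/asboolP.
move=> aE; have : a \in t.-unity_root.
  by apply/unity_rootP; apply: (mulfI a0); rewrite aE mulr1.
rewrite rootsM => /mapP[u].
by rewrite mem_enum memM => /asboolP uM ->.
Qed.

(** * The clones in the list *)

Definition equivariant_ops (F : fieldType) (S : set F) : operation_set F :=
  fun n => [set f | forall a, S a -> forall x, f (a \*o x) = a * f x].

Arguments equivariant_ops {F} S n _.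

Definition affine_ops (V : zmodType) : operation_set V :=
  fun n => [set f | affine f].

Arguments affine_ops : clear implicits.

Definition additive_ops (V : zmodType) : operation_set V :=
  fun n => [set f | affine f /\ f (fun=> 0) = 0].

Arguments additive_ops : clear implicits.

Lemma equivariant_clone (F : fieldType) (S : set F) :
  is_clone (equivariant_ops S) /\ equivariant_ops S 1%N (addition F).
Proof.
split; [split=> [//|n m f g fS gS a Sa x]|by move=> a _ x; rewrite mulrDr].
rewrite /composition -fS //; congr f; apply: funext => i; exact: gS.
Qed.

Lemma affine_composition (V : zmodType) n m (f : operation V n)
    (g : 'I_n -> operation V m) :
  affine f -> (forall i, affine (g i)) -> affine (composition f g).
Proof.
move=> fa ga x y; rewrite /composition -[RHS]fa -[LHS]fa; congr (f _ + _).
by apply: funext => i; exact: ga.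
Qed.

Lemma affine_clone (V : zmodType) :
  is_clone (affine_ops V) /\ affine_ops V 1%N (addition V).
Proof.
split; [split=> [n j x y|n m f g]|move=> x y].
- by rewrite /projection addr0.
- exact: affine_composition.
- by rewrite /addition /= !addr0 addrACA.
Qed.

Lemma additive_clone (V : zmodType) :
  is_clone (additive_ops V) /\ additive_ops V 1%N (addition V).
Proof.
have [[affine_proj affine_comp] affine_add] := affine_clone V.
split; [split=> [n j|n m f g [fa f0] ga]|].
- by split=> //; exact: affine_proj.
- split; first by apply: affine_comp => // i; case: (ga i).
  rewrite /composition -[RHS]f0; congr f.
  by apply: funext => i; case: (ga i).
- by split=> //; rewrite /addition addr0.
Qed.

(** * Clones over a prime field *)

Lemma linear_clone_Fp (p : nat) (C : operation_set 'F_p) :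
  prime p -> is_clone C -> C 1%N (addition 'F_p) -> linear_clone C.
Proof.
move=> p_prime clC Cadd; split=> // a.
have Cmuln k : C 0%N (fun x => k.+1%:R * x ord0).
  elim: k => [|k IHk].
    by case: clC => Cproj _; apply: (eq_operation _ (Cproj _ ord0)) => x; rewrite mul1r.
  apply: (eq_operation _ (clone_add clC Cadd IHk (clC.1 _ ord0))) => x /=.
  by rewrite -[in RHS]natr1 mulrDl mul1r.
(* Adding p makes the number of summands positive without changing a. *)
have -> : a = (a + p.-1).+1%:R.
  by rewrite -addnS prednK ?prime_gt0 // natrD (pcharf0 (pchar_Fp p_prime)) addr0 natr_Zp.
exact: Cmuln.
Qed.

(** Additive maps over a prime field are linear, because every scalar is a
    multiple of [1]. *)
Lemma affine_FpE (p n : nat) (f : operation 'F_p n) (x : 'I_n -> 'F_p) :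
  affine f ->
  f x = f (fun=> 0)
        + \sum_i (f (fun j => (j == i)%:R) - f (fun=> 0)) * x i.
Proof.
move=> fa; pose g y := f y - f (fun=> 0).
have gD y z : g (y \+ z) = g y + g z.
  by rewrite /g addrACA -fa -!addrA addNKr.
have g0 : g (fun=> 0) = 0 by rewrite /g subrr.
have gMn k y : g (k%:R \*o y) = k%:R * g y.
  elim: k => [|k IHk].
    by rewrite mul0r -g0; congr g; apply: funext => i; rewrite /= mul0r.
  rewrite -natr1 mulrDl mul1r -IHk -gD; congr g.
  by apply: funext => i; rewrite /= mulrDl mul1r.
have gZ a y : g (a \*o y) = a * g y by rewrite -[a]natr_Zp gMn.
pose e i : 'I_n -> 'F_p := fun j => (j == i)%:R.
have gsum r : g (fun j => \sum_(i <- r) x i * e i j) = \sum_(i <- r) x i * g (e i).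
  elim: r => [|i r IHr].
    by rewrite big_nil -g0; congr g; apply: funext => j; rewrite big_nil.
  rewrite big_cons -IHr -gZ -gD; congr g.
  by apply: funext => j; rewrite big_cons.
have -> : f x = f (fun=> 0) + g x by rewrite /g addrC subrK.
congr (_ + _).
have {1}-> : x = fun j => \sum_i x i * e i j.
  apply: funext => j; rewrite (bigD1 j) //= /e eqxx mulr1 big1 ?addr0 // => i ij.
  by rewrite eq_sym (negPf ij) mulr0.
by rewrite gsum; apply: eq_bigr => i _; rewrite mulrC.
Qed.

Lemma mem_affine_Fp (p n : nat) (C : operation_set 'F_p) (f : operation 'F_p n.+1) :
  linear_clone C -> affine f -> C n (fun=> f (fun=> 0)) -> C n f.
Proof.
move=> lC fa Cf0.
have Csum : C n (fun x => \sum_i (f (fun j => (j == i)%:R) - f (fun=> 0)) * x i).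
  apply: linear_clone_sum => // i.
  exact: linear_clone_scale (linear_clone_proj i lC).
by apply: (eq_operation _ (linear_clone_add lC Cf0 Csum)) => x; rewrite /= [RHS]affine_FpE.
Qed.

(** The solutions of [a ^+ t.+1 = a] are the [t]-th roots of unity and [0];
    commuting with the scalar [0] is the condition [f 0 = 0]. *)
Definition prime_field_clones (p : nat) : seq (operation_set 'F_p) :=
  [seq equivariant_ops [set a : 'F_p | a ^+ t.+1 = a] | t <- divisors p.-1]
  ++ [:: additive_ops 'F_p; affine_ops 'F_p; (fun=> setT)].

(** A clone of affine operations is determined by whether it contains a nonzero
    constant. A clone with a non-affine operation is determined by its
    multipliers. These are the roots of [X^t.+1 - X] for a divisor [t] of [p - 1]
    if [0] is a multiplier. Otherwise some operation has a value [c != 0] at [0],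
    and [c = a c] forces every multiplier [a] to be [1]: the clone is full. *)
Lemma prime_field_clones_complete (p : nat) (C : operation_set 'F_p) :
  prime p -> is_clone C -> C 1%N (addition 'F_p) -> C \in prime_field_clones p.
Proof.
move=> p_prime clC Cadd; have lC := linear_clone_Fp p_prime clC Cadd.
have eqC (D : operation_set 'F_p) : (forall n f, C n f <-> D n f) -> C = D.
  by move=> CD; apply: functional_extensionality_dep => n; apply/seteqP; split=> f /CD.
have [Ca|] := pselect (forall n f, C n f -> affine f).
  rewrite mem_cat; apply/orP; right.
  have [C0|] := pselect (forall n f, C n f -> f (fun=> 0) = 0).
    rewrite (eqC (additive_ops 'F_p)) ?mem_head // => n f.
    split=> [Cf|[fa f0]]; first by split; [exact: Ca|exact: C0].
    by apply: mem_affine_Fp => //; rewrite f0; exact: linear_clone0.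
  move=> /existsNP[k /existsNP[g /not_implyP[Cg /eqP g0]]].
  rewrite (eqC (affine_ops 'F_p)) ?inE ?eqxx ?orbT // => n f.
  split=> [|fa]; first exact: Ca.
  by apply: mem_affine_Fp => //; exact: linear_clone_const g0.
move=> /existsNP[k /existsNP[g /not_implyP[Cg ga]]].
have Cmem n (f : operation 'F_p n.+1) :
    (forall a, multiplier C a -> forall z, f (a \*o z) = a * f z) -> C n f.
  by apply: mem_nonaffine_clone => //; exists k, g.
rewrite mem_cat; apply/orP.
have [M0|M0] := pselect (multiplier C 0).
  left; have [t tp Mt] := multipliers_roots M0.
  apply/mapP; exists t.
    by rewrite card_Fp // in tp; rewrite -dvdn_divisors // -subn1 subn_gt0 prime_gt1.
  apply: eqC => n f; split=> [Cf a /Mt aM x|fS]; first exact: aM.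
  by apply: Cmem => a /Mt; exact: fS.
right; rewrite (eqC (fun=> setT)) ?inE ?eqxx ?orbT // => n f; split=> // _.
apply: Cmem => a aM z.
have -> : a = 1.
  move: M0 => /existsNP[m /existsNP[h /not_implyP[Ch /existsNP[y]]]].
  rewrite mul0r => /eqP; set y0 := _ \*o y => h0.
  apply: (mulIf h0); rewrite mul1r -aM //; congr h.
  by apply: funext => i; rewrite /y0 /= mul0r mulr0.
by rewrite mul1r; congr f; apply: funext => i; rewrite /= mul1r.
Qed.

Lemma prime_field_clonesP (p : nat) (C : operation_set 'F_p) :
  prime p ->
  is_clone C /\ C 1%N (addition 'F_p) <-> C \in prime_field_clones p.
Proof.
move=> p_prime; split=> [[]|]; first exact: prime_field_clones_complete.
rewrite mem_cat !inE => /orP[/mapP[t _ ->]|/or3P[]/eqP->].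
- exact: equivariant_clone.
- exact: additive_clone.
- exact: affine_clone.
- by [].
Qed.

(** The power [x ^+ t.+1] commutes with the [t]-th roots of unity; it commutes
    with a primitive [s]-th root of unity only if [s] divides [t]. *)
Lemma equivariant_roots_dvdn (F : finFieldType) (s t : nat) :
  (s %| #|F|.-1)%N ->
  equivariant_ops [set a : F | a ^+ s.+1 = a]
    = equivariant_ops [set a : F | a ^+ t.+1 = a] ->
  (s %| t)%N.
Proof.
move=> sF eqST; set q := #|F|.-1 in sF.
have q0 : (0 < q)%N by rewrite /q -subn1 subn_gt0 card_finNzRing_gt1.
have [z zprim] : exists z : F, q.-primitive_root z.
  have /hasP[z _ ?] : has q.-primitive_root [seq val u | u <- enum [set: {unit F}]%SET].
    apply: has_prim_root => //.
    - apply/allP => _ /mapP[u _ ->]; apply/unity_rootP.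
      by rewrite -FinRing.val_unitX /q -card_finField_unit expg_cardG ?inE.
    - by rewrite map_inj_uniq ?enum_uniq //; exact: val_inj.
    - by rewrite size_map -cardE card_finField_unit.
  by exists z.
have := dvdn_prim_root zprim sF; set w := _ ^+ _ => wprim.
have ft : equivariant_ops [set a : F | a ^+ t.+1 = a] 0%N (fun x => x ord0 ^+ t.+1).
  by move=> a /= aE x; rewrite exprMn aE.
rewrite -eqST in ft.
have ws : w ^+ s.+1 = w by rewrite exprS (prim_expr_order wprim) mulr1.
have w0 : w != 0 by rewrite (prim_root_eq0 wprim) -lt0n (dvdn_gt0 q0).
have := ft w ws (fun=> 1); rewrite /= mulr1 expr1n exprS => /(mulfI w0) /eqP.
by rewrite -(prim_order_dvd wprim).
Qed.

(** Every nonzero scalar preserves the axis [y = 0] and its complement, so [f]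
    commutes with all scalars. It lies in every equivariant clone, and separates
    them, as well as the full clone, from the clones of affine operations. *)
Lemma nonaffine_equivariant (F : fieldType) :
  let f : operation F 2 := fun x => if x ord_max == 0 then x ord0 else 0 in
  ~ affine f /\ forall S : set F, equivariant_ops S 1%N f.
Proof.
set f := (fun=> _); split=> [|S a _ x].
  move/(_ (fun i => if i == ord0 then 1 else 0) (fun i => if i == ord0 then 0 else 1)) /eqP.
  have n10 : (1 == 0 :> F) = false by exact: oner_eq0.
  by rewrite /f /= add0r !addr0 n10 eqxx !addr0 eq_sym n10.
rewrite /f /= mulf_eq0; case: (a =P 0) => [->|_] /=; first by rewrite !mul0r.
by case: ifP => _ /=; rewrite ?mulr0.
Qed.

Lemma equivariant_ops0 (F : fieldType) (S : set F) n (f : operation F n.+1) :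
  S 0 -> equivariant_ops S n f -> f (fun=> 0) = 0.
Proof.
move=> S0 fS; rewrite -[RHS](mul0r (f (fun=> 0))) -(fS _ S0); congr f.
by apply: funext => i; rewrite /= mul0r.
Qed.

Lemma prime_field_clones_uniq (p : nat) : prime p -> uniq (prime_field_clones p).
Proof.
move=> p_prime.
have divE t : t \in divisors p.-1 -> (t %| #|'F_p|.-1)%N.
  by rewrite card_Fp // -dvdn_divisors // -subn1 subn_gt0 prime_gt1.
have [fna fE] := nonaffine_equivariant 'F_p.
have const_affine : affine_ops 'F_p 0%N (fun=> 1) by move=> x y.
have one0 : (1 : 'F_p) <> 0 by apply/eqP; exact: oner_neq0.
rewrite cat_uniq; apply/and3P; split.
- rewrite map_inj_in_uniq ?divisors_uniq // => s t /divE sp /divE tp EE.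
  apply/eqP; rewrite eqn_dvd.
  by rewrite (equivariant_roots_dvdn sp EE) (equivariant_roots_dvdn tp (esym EE)).
- apply/hasPn => C; rewrite !inE => CE; apply/mapP => -[t _ CEt]; move: CE.
  have C0 n (f : operation 'F_p n.+1) : C n f -> f (fun=> 0) = 0.
    by rewrite CEt; apply: equivariant_ops0; rewrite /= exprS mul0r.
  case/or3P => /eqP CE.
  + have := fE [set a : 'F_p | a ^+ t.+1 = a]; rewrite -CEt CE => -[fa _]; exact: fna.
  + by apply: one0; apply: (C0 0%N (fun=> 1)); rewrite CE.
  + by apply: one0; apply: (C0 0%N (fun=> 1)); rewrite CE.
- have neq (C D : operation_set 'F_p) n f : ~ C n f -> D n f -> C != D.
    by move=> Cf Df; apply/eqP => CD; apply: Cf; rewrite CD.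
  rewrite /= !inE negb_or andbT -andbA; apply/and3P; split.
  + by apply: (neq _ _ 0%N (fun=> 1)) const_affine => -[].
  + by apply: (neq _ _ 0%N (fun=> 1)) => // -[].
  + exact: neq fna I.
Qed.

Local Close Scope ring_scope.

Theorem corollary1p3 (p : nat) (p_prime : prime p) :
  [set C : operation_set 'Z_p | is_clone C /\ C 1%N (addition 'Z_p)]
    #= `I_(size (divisors (p - 1)) + 3).
Proof.
suff FpE : [set C : operation_set 'F_p | is_clone C /\ C 1%N (addition 'F_p)]
    #= `I_(size (divisors (p - 1)) + 3).
  by move: FpE; rewrite pdiv_id.
have -> : [set C : operation_set 'F_p | is_clone C /\ C 1%N (addition 'F_p)]
    = [set` [fset C in prime_field_clones p]%fset].
  have mem_list C :
      (C \in [fset D in prime_field_clones p]%fset) = (C \in prime_field_clones p).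
    by rewrite in_fset.
  by apply/seteqP; split=> C /=; rewrite mem_list; move/prime_field_clonesP; apply.
apply/card_eq_fsetP.
by rewrite card_fseq undup_id ?prime_field_clones_uniq // size_cat size_map subn1.
Qed.
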